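(* For every integer $n\ge 2$, $$\varphi(n)\le\phi(n)<s_{-\infty}(n)\le \varphi(n+1)\le\phi(n+1).$$
   Context: For an integer $m\ge2$: $\varphi(m)=\max_{0<k<m}\sum_{i=0}^{m-k-1}k^i$ (integer $k$) and $\phi(m)=\sup_{1<x<m}\frac{x^{m-x}-1}{x-1}$ (real $x$). Identify $n=\{0,\dots,n-1\}$; $\omega^n$ is the set of functions $n\to\omega=\{0,1,\dots\}$ with pointwise addition; $1_i$ is the indicator of $\{i\}$; for $\hbar\in\omega^n$, ${\downarrow}\hbar=\{g\in\omega^n:g(i)<\hbar(i)\ \forall i\}$; for $A_i\subset\omega^n$, $\sum_{i\in n}A_i=\{\sum_i a_i:a_i\in A_i\}$. Define $\hbar^{[0]}(i)=\hbar^{\{0\}}(i)=\{1_i\}$, $\hbar^{\{m+1\}}(i)=\{x-x(i)1_i:x\in({\downarrow}\hbar)\cap\sum_{j\in n}\hbar^{[m]}(j)\}$, $\hbar^{[m+1]}(i)=\hbar^{\{m+1\}}(i)\cup\hbar^{[m]}(i)$, $\hbar^{[\omega]}(i)=\bigcup_m\hbar^{\{m\}}(i)$. $\hbar$ is $0$-generating if the zero function belongs to $\bigcup_{i\in n}\hbar^{[\omega]}(i)$. $s_{-\infty}(n)=\sup\{\min_{i\in n}\hbar(i):\hbar\in\omega^n\text{ is not $0$-generating}\}$. *)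

(* Defs.v *)
From HB Require Import structures.
From mathcomp Require Import all_boot all_order all_algebra.
From mathcomp Require Import all_classical all_reals all_analysis.

Set Implicit Arguments.
Unset Strict Implicit.
Unset Printing Implicit Defensive.

Import Order.TTheory GRing.Theory Num.Theory.

Local Open Scope classical_set_scope.
Local Open Scope ring_scope.

Definition varphi (m : nat) : nat :=
  (\max_(1 <= k < m) \sum_(0 <= i < m - k) k ^ i)%N.

(* Suprema are taken in [\bar R]: the real-valued [sup] is 0 on sets that are
   not bounded above, whereas [ereal_sup] is the true supremum. *)
Definition phi (R : realType) (m : nat) : \bar R :=
  ereal_sup [set ((x `^ (m%:R - x) - 1) / (x - 1))%:E
            | x in [set x : R | 1 < x < m%:R]].

Notation omega_pow n := {ffun 'I_n -> nat}.

Definition indic1 (n : nat) (i : 'I_n) : omega_pow n :=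
  [ffun j => nat_of_bool (j == i)].

Definition down (n : nat) (hbar : omega_pow n) : set (omega_pow n) :=
  [set g | forall i, (g i < hbar i)%N].

Definition sumset (n : nat) (A : 'I_n -> set (omega_pow n)) :
    set (omega_pow n) :=
  [set \sum_(i < n) a i
  | a in [set a : 'I_n -> omega_pow n | forall i, A i (a i)]].

(* The map x |-> x - x(i) 1_i; the natural-number subtraction never truncates. *)
Definition kill (n : nat) (i : 'I_n) (x : omega_pow n) : omega_pow n :=
  [ffun j => (x j - x i * indic1 i j)%N].

Definition gen_step (n : nat) (hbar : omega_pow n)
    (A : 'I_n -> set (omega_pow n)) (i : 'I_n) : set (omega_pow n) :=
  [set kill i x | x in down hbar `&` sumset A].

(* hbar^{[m]}(i) *)
Fixpoint gen_bracket (n : nat) (hbar : omega_pow n) (m : nat) (i : 'I_n) :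
    set (omega_pow n) :=
  if m is m'.+1
  then gen_step hbar (gen_bracket hbar m') i `|` gen_bracket hbar m' i
  else [set indic1 i].

(* hbar^{\{m\}}(i) *)
Definition gen_brace (n : nat) (hbar : omega_pow n) (m : nat) (i : 'I_n) :
    set (omega_pow n) :=
  if m is m'.+1 then gen_step hbar (gen_bracket hbar m') i
  else [set indic1 i].

(* hbar^{[omega]}(i) *)
Definition gen_omega (n : nat) (hbar : omega_pow n) (i : 'I_n) :
    set (omega_pow n) :=
  \bigcup_m gen_brace hbar m i.

Definition zero_generating (n : nat) (hbar : omega_pow n) : Prop :=
  (\bigcup_i gen_omega hbar i) 0.

(* The minimum is taken in [\bar R] because [nat] has no neutral element for
   [minn]; for 0 < n it is the minimum of the values of hbar. *)
Definition s_minus_infty (R : realType) (n : nat) : \bar R :=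
  ereal_sup [set \big[Order.min/+oo%E]_(i < n) ((hbar i)%:R : R)%:E
            | hbar in [set hbar : omega_pow n | ~ zero_generating hbar]].

(* Main.v *)
Require Import Defs.
From mathcomp Require Import all_boot all_order all_algebra.
From mathcomp Require Import all_classical all_reals all_analysis.
From mathcomp Require Import zify ring lra.

(** Write A_i for the set of all vectors generated at index i; both bounds on
    s_{-oo}(n) concern the constant functions h = H.

    Upper bound.  Vectors are considered up to permutation of the coordinates,
    which are listed in some order with values W(0), ..., W(n-1), the first l of
    them zero.  If A_i contains all such arrangements whenever i is one of the
    first l positions, add the l vectors attached to these positions to 1_j for
    the other indices j, and kill the last position: the values become
    0, ..., 0 (l+1 times), then 1 + l W(l), ..., 1 + l W(n-2).  This has one
    more zero, but one may also keep l fixed and iterate, which leads to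
    the values 0, ..., 0 (l+1 times), g(1), g(2), ... with
    g(j) = 1 + l + ... + l^(j-1), and all sums stay below H when
    1 + l + ... + l^(n-l) < H.  For l = n the zero vector has been reached.

    Lower bound.  Fix q >= 1 and N, and give the coordinates the weights
    q^min(r,N), r = 0, ..., n-1, in any order such that i has weight 1.  The
    property "the weighted sum is always at least q^(N+1)" holds for every
    vector of A_i other than 1_i: raising all ranks below that of j by one and
    giving j the rank 0 multiplies no weight by more than q, hence each summand
    weighs at least q^N (or the weight of j, for 1_j), while the killed
    coordinate removes at most H-1.  It suffices that
    H - 1 <= sum_r q^min(r,N) - q^(N+1), and Bernoulli's inequality for real
    exponents gives (x^(n-x)-1)/(x-1) <= sum_r x^min(r,N) - x^(N+1) with
    N = floor(n-x).  Strictness holds because the right-hand side attains its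
    maximum over q in [1,n]. *)

Import Order.TTheory GRing.Theory Num.Theory.
Import numFieldNormedType.Exports.

Local Open Scope ring_scope.

Set Implicit Arguments.
Unset Strict Implicit.
Unset Printing Implicit Defensive.

(** * Vectors reached at some stage *)

Lemma omega_pow_sumE n (I : finType) (a : I -> omega_pow n) v :
  (\sum_i a i) v = (\sum_i a i v)%N.
Proof. by rewrite sum_ffunE. Qed.

Lemma gen_bracket_le n (h : omega_pow n) m m' i :
  (m <= m')%N -> (gen_bracket h m i `<=` gen_bracket h m' i)%classic.
Proof.
move=> /subnK <-; elim: (m' - m)%N => [|d IH] x hx //.
by right; exact: IH.
Qed.

(** The brackets increase with [m], unlike the braces, so finitely many reached vectors share a
    common stage. *)
Definition reach n (h : omega_pow n) (i : 'I_n) : set (omega_pow n) :=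
  (\bigcup_m gen_bracket h m i)%classic.

Lemma reach_indic1 n (h : omega_pow n) i : reach h i (indic1 i).
Proof. by exists 0%N. Qed.

Lemma reach_kill n (h : omega_pow n) (a : 'I_n -> omega_pow n) i :
  (forall j, reach h j (a j)) -> Defs.down h (\sum_j a j) ->
  reach h i (kill i (\sum_j a j)).
Proof.
move=> ha hd.
have /choice[m hm] : forall j, exists m, gen_bracket h m j (a j).
  by move=> j; have [m _ hm] := ha j; exists m.
exists (\max_j m j).+1 => //; left; exists (\sum_j a j) => //; split=> //.
exists a => // j; apply: gen_bracket_le (hm j); exact: leq_bigmax.
Qed.

Lemma reach0_zero_generating n (h : omega_pow n) i :
  reach h i 0 -> zero_generating h.
Proof.
case=> m _ hm; exists i => //; elim: m hm => [|m IH] /= hm.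
  by exists 0%N.
by case: hm => [hm|/IH//]; exists m.+1.
Qed.

Lemma killE n (i : 'I_n) (x : omega_pow n) v :
  kill i x v = if v == i then 0%N else x v.
Proof.
rewrite !ffunE; case: eqP => [->|_]; first by rewrite muln1 subnn.
by rewrite muln0 subn0.
Qed.

(** * Upper bound: patterns with more and more zeros *)

Definition geom (k j : nat) : nat := (\sum_(0 <= i < j) k ^ i)%N.

Lemma geomS k j : geom k j.+1 = (1 + k * geom k j)%N.
Proof.
rewrite /geom big_nat_recl // expn0; congr addn.
by rewrite big_distrr; apply: eq_bigr => i _; rewrite expnS.
Qed.

Lemma leq_geom k k' j j' : (0 < k)%N -> (k <= k')%N -> (j <= j')%N ->
  (geom k j <= geom k' j')%N.
Proof.
move=> k0 kk' jj'; apply: (@leq_trans (geom k' j)).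
  rewrite /geom; apply: leq_sum => -[|i] _; first by rewrite !expn0.
  by rewrite leq_exp2r.
by rewrite /geom [leqRHS](big_cat_nat (leq0n j) jj') leq_addr.
Qed.

Definition pattern n (W : nat -> nat) (rho : 'I_n -> 'I_n) : omega_pow n :=
  [ffun v => W (rho v)].

(* The l zero positions of W are those of the indices at which the arranged
   pattern is available. *)
Definition reach_patterns n (h : omega_pow n) l (W : nat -> nat) :=
  (forall r, (r < l)%N -> W r = 0%N) /\
  forall rho : 'I_n -> 'I_n, injective rho -> forall i, (rho i < l)%N ->
    reach h i (pattern W rho).

Definition next_pattern l (W : nat -> nat) r : nat :=
  if (r <= l)%N then 0%N else (1 + l * W r.-1)%N.

(* The cycle q -> n, q+1 -> q, ..., n -> n-1. *)
Definition to_last n (q r : 'I_n.+1) : 'I_n.+1 :=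
  if r == q then ord_max else if (r < q)%N then r else inord r.-1.

Lemma to_lastE n (q r : 'I_n.+1) : nat_of_ord (to_last q r) =
  (if (r : nat) == q then n else if (r < q)%N then nat_of_ord r else r.-1).
Proof.
rewrite /to_last -val_eqE /=; case: ifP => //= _; case: ifP => // _.
by rewrite inordK //; case: r => /= r; lia.
Qed.

Lemma to_last_inj n (q : 'I_n.+1) : injective (to_last q).
Proof.
move=> [r hr] [r' hr'] /(congr1 val); rewrite /= !to_lastE /= => e.
apply: val_inj => /=; move: e; case: q => q hq /=.
by do ![case: ifP => ?]; lia.
Qed.

Lemma reach_patterns_next n (h : omega_pow n.+1) l W :
  (l <= n)%N -> (forall i r, (r <= n)%N -> (l * W r + 1 < h i)%N) ->
  reach_patterns h l W -> reach_patterns h l.+1 (next_pattern l W).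
Proof.
move=> ln hW [W0 hl]; split=> [r rl|rho rho_inj i il].
  by rewrite /next_pattern -ltnS rl.
(* [sg] puts [i] in the last position, the one to be killed. Positions beyond [l] come after [rho i]
   and move down by one, hence the [r.-1] in [next_pattern]. *)
pose sg v := to_last (rho i) (rho v).
have sg_inj : injective sg by move=> u v /to_last_inj/rho_inj.
pose a j := if (sg j < l)%N then pattern W sg else indic1 j.
have aE v : (\sum_j a j) v = (l * W (sg v) + (l <= sg v))%N.
  rewrite omega_pow_sumE (bigID (fun j => (sg j < l)%N)) /=; congr addn.
    rewrite (eq_bigr (fun=> W (sg v))); last first.
      by move=> j jl; rewrite /a jl ffunE.
    rewrite sum_nat_const; congr muln.
    transitivity #|[pred r : 'I_n.+1 | (r < l)%N]|.
      rewrite -!sum1_card [RHS](reindex_inj sg_inj).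
      by apply: eq_bigl => j; rewrite !inE.
    transitivity (\sum_(r < n.+1 | (r < l)%N) 1)%N.
      by rewrite -sum1_card; apply: eq_bigl.
    rewrite -(big_ord_widen _ (fun=> 1%N)) ?sum1_card ?card_ord //.
    exact: leqW.
  rewrite (eq_bigr (fun j => (v == j : nat))); last first.
    by move=> j /negbTE jl; rewrite /a jl ffunE.
  case: (leqP l (sg v)) => vl.
    rewrite (bigD1 v) -?leqNgt //= eqxx big1 // => j /andP[_ /negbTE].
    by rewrite eq_sym => ->.
  by rewrite big1 // => j jl; case: eqP => // vj; rewrite -vj vl in jl.
have -> : pattern (next_pattern l W) rho = kill i (\sum_j a j).
  apply/ffunP => v; rewrite killE aE ffunE /next_pattern.
  case: eqP => [->|/eqP vi]; first by rewrite -ltnS il.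
  have vi' : rho v != rho i by rewrite (inj_eq rho_inj).
  have := to_lastE (rho i) (rho v); rewrite val_eqE (negbTE vi') -/(sg v).
  move: vi'; rewrite -val_eqE /= => vi' sgE.
  case: (leqP (rho v) l) => vl.
    have sgl : (sg v < l)%N by rewrite sgE; case: ifP => ?; lia.
    by rewrite W0 // muln0 leqNgt sgl.
  have -> : sg v = (rho v).-1 :> nat by rewrite sgE; case: ifP => ?; lia.
  have -> : (l <= (rho v).-1)%N by lia.
  by rewrite addnC.
apply: reach_kill => [j|v].
  by rewrite /a; case: ifP => jl; [exact: hl | exact: reach_indic1].
have sgn : (sg v <= n)%N by rewrite -ltnS.
rewrite aE; apply: leq_ltn_trans (hW v _ sgn).
by rewrite leq_add2l leq_b1.
Qed.

Lemma reach_patternsW n (h : omega_pow n) l W :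
  reach_patterns h l.+1 W -> reach_patterns h l W.
Proof.
case=> W0 hW; split=> [r rl|rho rho_inj i il]; first by apply: W0; exact: leqW.
by apply: hW => //; exact: leqW.
Qed.

Lemma reach_patterns_geom n (h : omega_pow n.+1) l :
  (forall k i, (0 < k <= n.+1)%N -> (geom k (n.+2 - k) < h i)%N) ->
  (0 < l <= n.+1)%N ->
  exists2 W, reach_patterns h l W &
    forall r, (r <= n)%N -> (W r <= geom l (r.+1 - l))%N.
Proof.
move=> hH; elim: l => // -[|l] IH.
  move=> _.
  exists (next_pattern 0 (fun=> 0%N)) => [|r _].
    apply: reach_patterns_next => // i r _.
    have := hH n.+1 i; rewrite leqnn => /(_ isT); apply: leq_trans.
    by rewrite subSnn geomS /geom big_geq.
  rewrite /next_pattern; case: r => //= r.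
  by rewrite subn1 /= geomS mul0n addn0 leq_addr.
move=> /andP[_ ln].
have {}[|W hW bW] := IH; first exact: ltnW.
have hstep V : (forall r, (r <= n)%N -> (V r <= geom l.+1 (r.+1 - l.+1))%N) ->
    forall i r, (r <= n)%N -> (l.+1 * V r + 1 < h i)%N.
  move=> bV i r rn; apply: leq_ltn_trans (hH l.+1 i (ltnW ln)).
  have -> : (n.+2 - l.+1 = (n.+1 - l.+1).+1)%N by lia.
  rewrite geomS [leqRHS]addnC leq_add2r leq_mul2l /=.
  by apply: leq_trans (bV _ rn) _; apply: leq_geom => //; lia.
(* Passing from [W] to [l.+2] zeros at once would give a geometric sum one term too long. Rounds
   that keep only [l.+1] zeros sharpen the bound first: the shift from [r.-1] to [r] extends the
   sharp range by one position per round. *)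
have [V hV bV] : exists2 V, reach_patterns h l.+1 V &
    forall r, (r <= n)%N -> (V r <= geom l.+1 (r - l.+1))%N.
  have : forall j, exists2 V, reach_patterns h l.+1 V &
      forall r, (r <= n)%N ->
        (V r <= geom l.+1 (if (r < j)%N then r - l.+1 else r.+1 - l.+1))%N.
    elim=> [|j [V hV bV]]; first by exists W.
    exists (next_pattern l.+1 V).
      apply: reach_patternsW; apply: reach_patterns_next => //.
      apply: hstep => r rn; apply: leq_trans (bV _ rn) _.
      by apply: leq_geom => //; case: ifP => ? //; lia.
    move=> r rn; rewrite /next_pattern; case: (leqP r l.+1) => // lr.
    have rn' : (r.-1 <= n)%N by lia.
    apply: (@leq_trans (1 + l.+1 * geom l.+1
      (if (r.-1 < j)%N then r.-1 - l.+1 else r.-1.+1 - l.+1))%N).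
      by rewrite leq_add2l leq_mul2l bV.
    by rewrite -geomS; apply: leq_geom => //; do 2?[case: ifP => ?]; lia.
  move=> /(_ n.+1)[V hV bV]; exists V => // r rn.
  by have := bV r rn; rewrite ltnS rn.
exists (next_pattern l.+1 V) => [|r rn].
  apply: reach_patterns_next => //; apply: hstep => r rn.
  by apply: leq_trans (bV _ rn) _; apply: leq_geom => //; lia.
rewrite /next_pattern; case: (leqP r l.+1) => // lr.
apply: (@leq_trans (1 + l.+1 * geom l.+1 (r.-1 - l.+1))%N).
  by rewrite leq_add2l leq_mul2l bV //; lia.
by rewrite -geomS; apply: leq_geom => //; lia.
Qed.

Lemma zero_generating_geom n (h : omega_pow n.+1) :
  (forall k i, (0 < k <= n.+1)%N -> (geom k (n.+2 - k) < h i)%N) ->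
  zero_generating h.
Proof.
move=> hH; have [|W [W0 hW] _] := @reach_patterns_geom n h n.+1 hH.
  by rewrite leqnn.
apply: (@reach0_zero_generating _ _ ord0).
have := hW id (fun _ _ e => e) ord0 (ltn_ord _).
suff -> : pattern W id = 0 :> omega_pow n.+1 by [].
by apply/ffunP => v; rewrite !ffunE W0.
Qed.

Lemma s_minus_infty_le (R : realType) n : (0 < n)%N ->
  (s_minus_infty R n <= ((varphi n.+1)%:R : R)%:E)%E.
Proof.
case: n => // n _; apply: ge_ereal_sup => _ [h hh <-].
apply: contrapT => hlt; apply: hh; apply: zero_generating_geom => k i /andP[k0 kn].
rewrite ltnNge; apply/negP => hi; apply: hlt.
apply: (@le_trans _ _ ((h i)%:R)%:E); first exact: bigmin_le_cond.
rewrite lee_fin ler_nat (leq_trans hi) //.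
by apply: (@leq_bigmax_seq _ _ xpredT (fun k => geom k (n.+2 - k))%N k); rewrite ?mem_index_iota ?k0.
Qed.

(** * Lower bound: weights *)

(* Positions are counted downwards, so that [to_last] moves a position to weight 1
   and raises the others by a factor of at most q. *)
Definition weight (R : realType) (q : R) N n (r : 'I_n.+1) : R :=
  q ^+ minn (n - r) N.

Definition weight_gap (R : realType) (q : R) N n : R :=
  \sum_(r < n.+1) q ^+ minn r N - q ^+ N.+1.

(** All arrangements giving [j] the weight 1 are included, because the induction changes the
    arrangement. *)
Definition heavy (R : realType) (q : R) N n (j : 'I_n.+1)
    (a : omega_pow n.+1) : Prop :=
  a = indic1 j \/ a j = 0%N /\
  forall s : 'I_n.+1 -> 'I_n.+1, injective s -> s j = ord_max ->
    q ^+ N.+1 <= \sum_v weight q N (s v) * (a v)%:R.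

Lemma weight_to_last (R : realType) (q : R) N n (p r : 'I_n.+1) :
  1 <= q -> weight q N (to_last p r) <= q * weight q N r.
Proof.
move=> q1; rewrite /weight -exprS ler_weXn2l // to_lastE.
have := ltn_ord r; do 2?[case: ifP => ?]; lia.
Qed.

Lemma sum_weight (R : realType) (q : R) N n (s : 'I_n.+1 -> 'I_n.+1) :
  injective s -> \sum_j weight q N (s j) = \sum_(r < n.+1) q ^+ minn r N.
Proof.
move=> s_inj; rewrite -(reindex_inj s_inj (F := @weight R q N n) (P := xpredT)) /=.
rewrite (reindex_inj rev_ord_inj) /=; apply: eq_bigr => r _.
by rewrite /weight /= subSS subKn // -ltnS.
Qed.

Lemma heavy_ge_weight (R : realType) (q : R) N n (s : 'I_n.+1 -> 'I_n.+1) j a :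
  1 <= q -> injective s -> heavy q N j a ->
  weight q N (s j) <= \sum_v weight q N (s v) * (a v)%:R.
Proof.
move=> q1 s_inj [->|[_ ha]].
  rewrite (bigD1 j) //= big1 ?addr0 ?ffunE ?eqxx ?mulr1 // => v /negbTE vj.
  by rewrite ffunE vj mulr0.
apply: (@le_trans _ _ (q ^+ N)); first by rewrite ler_weXn2l // geq_minr.
have q0 : 0 < q by lra.
rewrite -(ler_pM2l q0) -exprS.
apply: le_trans (ha (fun v => to_last (s j) (s v)) _ _) _.
- by move=> u v /to_last_inj/s_inj.
- by apply: val_inj; rewrite /= to_lastE eqxx.
rewrite mulr_sumr; apply: ler_sum => v _.
by rewrite mulrA ler_wpM2r // weight_to_last.
Qed.

Lemma heavy_kill (R : realType) (q : R) N n c (h : omega_pow n.+1) a i :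
  1 <= q -> c%:R <= weight_gap q N n -> (forall v, (h v <= c.+1)%N) ->
  (forall j, heavy q N j (a j)) -> Defs.down h (\sum_j a j) ->
  heavy q N i (kill i (\sum_j a j)).
Proof.
move=> q1 hc hh ha hd; right; split=> [|s s_inj si]; first by rewrite killE eqxx.
have w0 r : 0 <= weight q N (n := n) r by rewrite exprn_ge0 //; lra.
have [ai|[ai0 ai]] := ha i; last first.
  apply: le_trans (ai s s_inj si) _; apply: ler_sum => v _.
  apply: ler_wpM2l => //; rewrite ler_nat killE.
  case: eqP => [->|_]; first by rewrite ai0.
  by rewrite omega_pow_sumE (bigD1 i) //= leq_addr.
pose x : omega_pow n.+1 := \sum_j a j.
rewrite -/x in hd *.
have xi : (x i)%:R <= c%:R :> R.
  by rewrite ler_nat -ltnS (leq_trans (hd i)).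
have wi : weight q N (s i) = 1 by rewrite /weight si subnn min0n.
have -> : \sum_v weight q N (s v) * (kill i x v)%:R =
    \sum_v weight q N (s v) * (x v)%:R - (x i)%:R.
  rewrite (bigD1 i) //= [in RHS](bigD1 i) //= killE eqxx wi mulr0 mul1r.
  rewrite add0r [RHS]addrAC subrr add0r; apply: eq_bigr => v /negbTE vi.
  by rewrite killE vi.
have : \sum_(r < n.+1) q ^+ minn r N <=
    \sum_v weight q N (s v) * (x v)%:R.
  under [leRHS]eq_bigr do rewrite omega_pow_sumE natr_sum mulr_sumr.
  rewrite exchange_big -(sum_weight q N s_inj); apply: ler_sum => j _.
  exact: heavy_ge_weight.
by move: hc; rewrite /weight_gap; lra.
Qed.

Lemma not_zero_generating (R : realType) (q : R) N n c (h : omega_pow n.+1) :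
  1 <= q -> c%:R <= weight_gap q N n -> (forall v, (h v <= c.+1)%N) ->
  ~ zero_generating h.
Proof.
move=> q1 hc hh [i _ [m _ hm]].
have hb k j x : gen_bracket h k j x -> heavy q N j x.
  elim: k j x => [|k IH] j x /=; first by move=> ->; left.
  move=> [[y [yd [a ha ay]] <-]|/IH//]; rewrite -ay in yd *.
  apply: (heavy_kill _ q1 hc hh) => // l; exact/IH/ha.
have : heavy q N i 0.
  by case: m hm => [|m] hm; [apply: (hb 0%N) | apply: (hb m.+1); left].
case=> [/ffunP/(_ i)|[_ h0]]; first by rewrite !ffunE eqxx.
have := h0 (to_last i) (@to_last_inj _ _).
rewrite big1 => [|v _]; last by rewrite ffunE mulr0.
have -> : to_last i i = ord_max by apply: val_inj; rewrite /= to_lastE eqxx.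
by move=> /(_ erefl); rewrite leNgt exprn_gt0 //; lra.
Qed.

(** * Real inequalities and the strict lower bound *)

(** With u = ln x, the bound exp z >= 1 + z at z = (1-t)u and z = -tu gives [h1] and [h2]; weighting
    them by t and 1-t cancels u. *)
Lemma powR_bernoulli (R : realType) (x t : R) : 0 < x -> 0 <= t <= 1 ->
  x `^ t <= 1 + t * (x - 1).
Proof.
move=> x0 /andP[t0 t1]; rewrite /powR gt_eqF //.
set u := ln x; rewrite -[x in leRHS]lnK ?posrE // -/u.
have A0 : 0 < expR (t * u) by exact: expR_gt0.
have h1 : expR (t * u) * (1 + (1 - t) * u) <= expR u.
  have -> : expR u = expR (t * u) * expR ((1 - t) * u).
    by rewrite -expRD; congr expR; ring.
  by rewrite ler_pM2l // expR_ge1Dx.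
have h2 : expR (t * u) * (1 - t * u) <= 1.
  rewrite -[leRHS](mulfV (lt0r_neq0 A0)) ler_pM2l // -expRN.
  exact: expR_ge1Dx.
have := ler_wpM2l t0 h1; have : 0 <= 1 - t by lra.
by move=> /ler_wpM2l/(_ _ _ h2); nra.
Qed.

Lemma sum_expr_minn (R : realType) (q : R) N n : (N <= n)%N ->
  (q - 1) * \sum_(r < n.+1) q ^+ minn r N =
  q ^+ N.+1 - 1 + (q - 1) * (n - N)%:R * q ^+ N.
Proof.
move=> /subnKC <-; rewrite addKn; elim: (n - N)%N => [|d IH].
  rewrite addn0 mulr0 mul0r addr0 subrX1; congr (_ * _); apply: eq_bigr => r _.
  by rewrite (minn_idPl _) // -ltnS.
rewrite addnS big_ord_recr /= mulrDr IH (minn_idPr _); last by lia.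
by rewrite -natr1; ring.
Qed.

(** Let t = n+1-x-N be the fractional part of the exponent. Multiplied by x-1, the weight gap equals
    x^N (1 + t(x-1)) - 1, so the claim is Bernoulli's inequality for x^t. *)
Lemma phi_value_le (R : realType) n (x : R) : 1 < x < n.+1%:R ->
  exists2 N, (N <= n)%N &
    (x `^ (n.+1%:R - x) - 1) / (x - 1) <= weight_gap x N n.
Proof.
move=> /andP[x1 xn]; pose N := Num.truncn (n.+1%:R - x).
have y0 : 0 <= n.+1%:R - x by lra.
have Nn : (N <= n)%N by rewrite /N truncn_le_nat; lra.
exists N => //.
have /andP[N1 N2] : N%:R <= n.+1%:R - x < N.+1%:R by exact: truncn_itv.
have x0 : x != 0 by rewrite gt_eqF //; lra.
rewrite ler_pdivrMr ?subr_gt0 // mulrC /weight_gap mulrBr.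
rewrite sum_expr_minn // natrB //.
have -> : x `^ (n.+1%:R - x) = x ^+ N * x `^ (n.+1%:R - x - N%:R).
  rewrite -powR_mulrn; last by lra.
  by rewrite -powRD ?x0 ?implybT //; congr (_ `^ _); ring.
have : x `^ (n.+1%:R - x - N%:R) <= 1 + (n.+1%:R - x - N%:R) * (x - 1).
  apply: powR_bernoulli; first by lra.
  by move: N2; rewrite -natr1 => ?; apply/andP; split; lra.
have xN : 0 < x ^+ N by rewrite exprn_gt0 //; lra.
rewrite -(ler_pM2l xN) => le1; rewrite lerBlDr (le_trans le1) //.
by rewrite exprS -natr1; lra.
Qed.

Lemma weight_gap_max (R : realType) N n : exists2 c : R, 1 <= c &
  forall q, 1 <= q <= n.+1%:R -> weight_gap q N n <= weight_gap c N n.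
Proof.
pose p : {poly R} := \sum_(r < n.+1) 'X^(minn r N) - 'X^(N.+1).
have pE q : weight_gap q N n = p.[q].
  rewrite /p hornerD hornerN hornerXn horner_sum; congr (_ - _).
  by apply: eq_bigr => r _; rewrite hornerXn.
have [||c] := @EVT_max R (horner p) 1 n.+1%:R.
- by rewrite ler1n.
- by apply: continuous_subspaceT => x; exact: continuous_horner.
rewrite in_itv /= => /andP[c1 _] cmax; exists c => // q hq.
by rewrite !pE cmax // in_itv.
Qed.

Lemma phi_lt_s_minus_infty (R : realType) n :
  (phi R n.+1 < s_minus_infty R n.+1)%E.
Proof.
have /choice[c hc] : forall N, exists c : R, 1 <= c /\
    forall q, 1 <= q <= n.+1%:R -> weight_gap q N n <= weight_gap c N n.
  by move=> N; have [c c1 hc] := @weight_gap_max R N n; exists c.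
pose M (N : 'I_n.+1) := weight_gap (c N) N n.
have [N _ Nmax] := @arg_maxP _ _ _ ord0 xpredT M isT.
(* This makes [truncn] the floor of [M N]; for N = 0 and q = 1 the gap is n. *)
have M0 : 0 <= M N.
  have [_ h] := hc 0%N; apply: le_trans (Nmax ord0 isT).
  apply: le_trans (h 1 _); last by rewrite lexx ler1n.
  rewrite /weight_gap expr1n subr_ge0.
  by under eq_bigr do rewrite expr1n; rewrite sumr_const card_ord ler1n.
(* H - 1 <= [M N] prevents generation of zero, and [M N] < H yields strictness. *)
pose H := (Num.truncn (M N)).+1.
have /andP[HM MH] : (Num.truncn (M N))%:R <= M N < H%:R by exact: truncn_itv.
apply: (@le_lt_trans _ _ (M N)%:E).
  apply: ge_ereal_sup => _ [x hx <-]; rewrite lee_fin.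
  have [N' N'n hN'] := phi_value_le hx.
  apply: le_trans hN' _; apply: le_trans (Nmax (Ordinal (N'n : (N' < n.+1)%N)) isT).
  have [_] := hc N'; apply; case/andP: hx => x1 xn.
  by rewrite !ltW.
apply: (@lt_le_trans _ _ (H%:R)%:E); first by rewrite lte_fin.
apply: le_ereal_sup_tmp.
exists (\big[Order.min/+oo%E]_(i < n.+1) (H%:R)%:E).
  exists [ffun=> H]; last by apply: eq_bigr => i _; rewrite ffunE.
  apply: (not_zero_generating (proj1 (hc N)) HM) => v.
  by rewrite ffunE.
by apply: le_bigmin => //; exact: leey.
Qed.

(** * Comparison of [varphi] and [phi] *)

Lemma phi_value_geom (R : realType) n k : (1 < k <= n)%N ->
  (geom k (n.+1 - k))%:R = (k%:R `^ (n.+1%:R - k%:R) - 1) / (k%:R - 1) :> R.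
Proof.
move=> /andP[k1 kn].
have k0 : (k%:R : R) - 1 != 0 by rewrite subr_eq0 pnatr_eq1; lia.
rewrite -natrB ?(leqW kn) // powR_mulrn ?ler0n // subrX1 mulrAC divff // mul1r.
rewrite /geom big_mkord natr_sum; apply: eq_bigr => i _; exact: natrX.
Qed.

(** This covers the term k = 1 of [varphi], which is only the limit of the quotient as x = 1 + t
    tends to 1. *)
Lemma phi_ge (R : realType) n : (0 < n)%N -> ((n%:R : R)%:E <= phi R n.+1)%E.
Proof.
move=> n0; apply/lee_addgt0Pr => e e0.
have n1 : (1 : R) <= n%:R by rewrite ler1n.
(* The bound 1/2 keeps 1 + t below n + 1; the other one gives (1 + (n-e)t)(1 + t^2) <= 1 + nt at the
   end. *)
pose t := Num.min (2^-1) (e / n.+1%:R) : R.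
have t0 : 0 < t by rewrite lt_min invr_gt0 ltr0n divr_gt0.
have t2 : t <= 2^-1 by rewrite ge_min lexx.
have te : n.+1%:R * t <= e.
  by rewrite mulrC -ler_pdivlMr ?ltr0n // ge_min lexx orbT.
rewrite -leeBlDr //; apply: le_ereal_sup_tmp.
exists (((1 + t) `^ (n.+1%:R - (1 + t)) - 1) / (1 + t - 1))%:E.
  exists (1 + t) => //=; apply/andP; split; first by lra.
  by rewrite -natr1; lra.
rewrite -EFinB lee_fin [1 + t - 1]addrC addKr ler_pdivlMr //.
have t1 : 0 < 1 + t by lra.
have -> : n.+1%:R - (1 + t) = n%:R - t by rewrite -natr1; ring.
rewrite powRB; last by rewrite (gt_eqF t1) implybT.
rewrite powR_mulrn; last exact: ltW.
have hT : (1 + t) `^ t <= 1 + t * t.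
  have := @powR_bernoulli R (1 + t) t t1; rewrite [1 + t - 1]addrC addKr; apply.
  by apply/andP; split; lra.
have hn : 1 + n%:R * t <= (1 + t) ^+ n.
  elim: (n) => [|m IH]; first by rewrite mul0r addr0 expr0.
  rewrite exprS -natr1; apply: le_trans (ler_wpM2l (ltW t1) IH).
  have : 0 <= m%:R * (t * t) by rewrite mulr_ge0 // mulr_ge0 // ltW.
  lra.
have P0 : 0 < (1 + t) `^ t by exact: powR_gt0.
rewrite lerBrDr ler_pdivlMr //.
apply: le_trans hn; move: te; rewrite -natr1 => te.
have [neg|pos] := lerP ((n%:R - e) * t + 1) 0.
  apply: (@le_trans _ _ 0); first by rewrite mulr_le0_ge0 // ltW.
  by rewrite addr_ge0 // mulr_ge0 // ltW.
apply: le_trans (ler_wpM2l (ltW pos) hT) _.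
have h1 : 0 <= t * (e - (n%:R + 1) * t) by rewrite mulr_ge0 ?subr_ge0 //; exact: ltW.
have h2 : 0 <= n%:R * (t * t) * (1 - t).
  by rewrite !mulr_ge0 ?ler0n //; lra.
have h3 : 0 <= e * (t * t * t) by rewrite !mulr_ge0 // ltW.
lra.
Qed.

Lemma varphi_le_phi (R : realType) n : (0 < n)%N ->
  (((varphi n.+1)%:R : R)%:E <= phi R n.+1)%E.
Proof.
move=> n0; rewrite /varphi big_seq_cond.
apply: (big_ind (fun m : nat => ((m%:R : R)%:E <= phi R n.+1)%E)).
- by apply: le_trans (phi_ge R n0); rewrite lee_fin ler_nat.
- by move=> a b ha hb; rewrite /maxn; case: ifP.
move=> k; rewrite mem_index_iota andbT => /andP[].
case: k => // -[|k] _ kn.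
  rewrite subn1 /=; apply: le_trans (phi_ge R n0); rewrite lee_fin ler_nat.
  under eq_bigr do rewrite exp1n.
  by rewrite sum_nat_const_nat subn0 muln1.
apply: le_ereal_sup_tmp; exists ((geom k.+2 (n.+1 - k.+2))%:R)%:E => //.
exists k.+2%:R; last by rewrite phi_value_geom.
by rewrite /= ltr_nat ltr1n.
Qed.

Unset Implicit Arguments.

Theorem theorem1p16 (R : realType) (n : nat) (hn : (2 <= n)%N) :
  [/\ (((varphi n)%:R : R)%:E <= phi R n)%E,
      (phi R n < s_minus_infty R n)%E,
      (s_minus_infty R n <= ((varphi n.+1)%:R : R)%:E)%E
    & (((varphi n.+1)%:R : R)%:E <= phi R n.+1)%E].
Proof.
case: n hn => // n n1; split.
- exact: varphi_le_phi.
- exact: phi_lt_s_minus_infty.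
- exact: s_minus_infty_le.
- exact: varphi_le_phi.
Qed.
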